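(* Let $T > 0$. Let $v_1,\dots,v_n \in \mathbb{R}^d$ be any fixed vectors, and let $\varepsilon_1,\ldots,\varepsilon_n$ be independent Rademacher random variables. Then there exists an online algorithm that discards some of the terms $\varepsilon_j v_j$ (and accepts the others) so that, for each $k \in \{1,\dots,n\}$, $$\Bigl\| \sum_{j \le k,\ j \text{ accepted}} \varepsilon_j v_j \Bigr\|_\infty \le 2T \quad \text{deterministically},$$ and $$\mathbb{E}\,\#\{\text{discarded}\} \le \frac{\pi}{2T} \sum_{j=1}^n \|v_j\|_2 .$$
   Context: Here $\pi = 3.14159\ldots$, and $\|\cdot\|_\infty$ and $\|\cdot\|_2$ are the maximum norm and the Euclidean norm on $\mathbb{R}^d$. A Rademacher random variable takes the values $+1$ and $-1$ with probability $1/2$ each. Online algorithm: the steps $\varepsilon_1 v_1, \varepsilon_2 v_2,\dots$ are revealed one at a time. Upon observing step $\varepsilon_j v_j$, the algorithm must immediately decide whether to accept or discard it; the decision may depend on the steps observed so far (and on internal randomness of the algorithm independent of the signs), but not on future steps, and it cannot be changed later. ''Deterministically'' means for every realization of the signs and of the internal randomness. The expectation is over the signs and the internal randomness, and $\#\{\text{discarded}\}$ is the number of indices $j\in\{1,\dots,n\}$ whose term is discarded. *)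

(* Defs.v *)
From HB Require Import structures.
From mathcomp Require Import all_boot all_order all_algebra.
From mathcomp Require Import all_classical all_reals all_analysis.

Set Implicit Arguments.
Unset Strict Implicit.
Unset Printing Implicit Defensive.

Import Order.TTheory GRing.Theory Num.Theory.
Import numFieldNormedType.Exports.

Local Open Scope classical_set_scope.
Local Open Scope ring_scope.

Definition l2norm (R : realType) (d : nat) (x : 'rV[R]_d) : R :=
  Num.sqrt (\sum_(i < d) x ord0 i ^+ 2).

Definition rademacher (R : realType) (disp : measure_display)
    (T : measurableType disp) (P : probability T R) (X : T -> R) : Prop :=
  P (X @^-1` [set 1]) = (2^-1)%:E /\ P (X @^-1` [set -1]) = (2^-1)%:E.

Definition mutually_independent (R : realType) (disp : measure_display)
    (T : measurableType disp) (P : probability T R) (I : finType)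
    (X : I -> T -> R) : Prop :=
  forall (J : {set I}) (B : I -> set R),
    (forall i, i \in J -> measurable (B i)) ->
    P (\bigcap_(i in [set` J]) (X i @^-1` B i)) =
    (\prod_(i in J) P (X i @^-1` B i))%E.

(* [accept u h] is the decision on the last entry of [h], the list of all the
   steps observed so far (oldest first, the current one included), when the
   internal randomness is [u].  Earlier decisions are functions of [u] and the
   prefixes of [h], so they need not be passed as arguments.  Independence of the
   internal randomness and the signs is expressed by taking the product of
   [seed_law] with the law of the space carrying the signs. *)
Record online_algorithm (R : realType) (d : nat) := OnlineAlgorithm {
  seed_display : measure_display;
  seed : measurableType seed_display;
  seed_law : probability seed R;
  accept : seed -> seq 'rV[R]_d -> bool;
  measurable_accept :
    forall h : seq 'rV[R]_d, measurable_fun setT (fun u => accept u h) }.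

Section run.
Context (R : realType) (d n : nat).
Variables (A : online_algorithm R d) (v : 'I_n -> 'rV[R]_d).

Definition observed (s : 'I_n -> R) (j : 'I_n) : seq 'rV[R]_d :=
  [seq s i *: v i | i : 'I_n <- enum 'I_n & (i <= j)%N].

Definition accepted (s : 'I_n -> R) (u : seed A) (j : 'I_n) : bool :=
  accept u (observed s j).

Definition accepted_sum (s : 'I_n -> R) (u : seed A) (k : 'I_n) : 'rV[R]_d :=
  \sum_(j < n | (j <= k)%N && accepted s u j) s j *: v j.

Definition num_discarded (s : 'I_n -> R) (u : seed A) : nat :=
  #|[set j : 'I_n | ~~ accepted s u j]%SET|.

End run.

(* Main.v *)
Require Import Defs.
From HB Require Import structures.
From mathcomp Require Import all_boot all_order all_algebra.
From mathcomp Require Import all_classical all_reals all_analysis.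
From mathcomp Require Import measurable_realfun ring lra.

Set Implicit Arguments.
Unset Strict Implicit.
Unset Printing Implicit Defensive.

Import Order.TTheory GRing.Theory Num.Theory.
Import numFieldNormedType.Exports.

Local Open Scope classical_set_scope.
Local Open Scope ring_scope.

(** Consider first a random start.  On the cube [-T, T)^d put the density p
    proportional to the product of the cos^2 (pi x_i / 2T), the squared ground
    state of the Dirichlet Laplacian.  Start the walk at x ~ p and treat each
    proposed step u = +v or -v by the Metropolis rule: accept it with
    probability min (1, p (x + u) / p x).  The proposal is symmetric, so p stays
    stationary; the walk never leaves the cube, so the accepted sum, being a
    difference of two points of the cube, has sup norm at most 2T.  The
    probability of rejection is the total variation distance between p and its
    translate by v, and a Hellinger bound makes it at most pi / (2T) |v|_2.

    Two changes turn this into a finite argument, without integration over R^d.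

    Discrete fibres.  Modulo 2T in each coordinate, the 2^d translates of y by
    the vectors of {0, T}^d form a fibre, on which p sums to exactly 1 because
    cos^2 + sin^2 = 1 (fibre_sum_density).  The Hellinger affinity of p and its
    translate on a fibre is at least the product of the cos (pi v_i / 2T),
    again exactly on each fibre, which bounds the rejected mass
    (fibre_sum_overlap).  A step by v moves mass between the fibres of y and
    y + v only, in equal amounts both ways (fluxN); stationarity therefore holds
    up to a difference g(y) - g(y - v), and averaging over the large box
    { y + sum_j c_j v_j : 0 <= c_j < M } makes that term O(1/M)
    (box_avg_telescope).

    No randomness in the algorithm.  For a fixed start, the algorithm that
    accepts a step exactly when this keeps it in the cube and minimises the
    expected number of later discards is at least as good as the Metropolis
    rule.  Its expected cost satisfies a Bellman recursion (expected_cost), and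
    the averaged inequality shows that some start costs at most
    pi / (2T) sum_j |v_j|_2 + O(1/M).  With n signs the cost is a multiple of
    2^-n, so for M large the error term disappears (cheap_start).  The
    algorithm has this start built in and a one-point seed space.

    What remains is to identify the cost with the expectation.  For measurability
    on the null event that some sign is not 1 or -1, the algorithm discards
    every step that is neither v_j nor -v_j, so that the number of discards is a
    function of finitely many events (decisions_sign_class,
    expectation_pattern). *)

(** * The squared cosine on the fibres of the line *)

Section Fibres.
Context (R : realType) (T : R).
Hypothesis T_gt0 : 0 < T.
Implicit Types (t h : R).

Definition angle h : R := pi * h / (2 * T).
Definition wave t : R := cos (angle t).
Definition bump t : R := if -T <= t < T then wave t else 0.
Definition wrap t : R := t - 2 * T * (Num.floor ((t + T) / (2 * T)))%:~R.

Let T_neq0 : T != 0. Proof. by rewrite gt_eqF. Qed.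

Lemma wrap_itv t : -T <= wrap t < T.
Proof.
have /andP[] := floor_itv ((t + T) / (2 * T)).
have T2 : 0 < 2 * T by rewrite mulr_gt0.
rewrite ler_pdivlMr // ltr_pdivrMr // intrD /wrap => h1 h2.
apply/andP; split; nra.
Qed.

Lemma wrapD t h : -T <= wrap t + h < T -> wrap (t + h) = wrap t + h.
Proof.
rewrite /wrap; set k := Num.floor _ => /andP[h1 h2].
suff -> : Num.floor ((t + h + T) / (2 * T)) = k by ring.
have T2 : 0 < 2 * T by rewrite mulr_gt0.
apply: floor_def; rewrite ler_pdivlMr // ltr_pdivrMr // intrD.
apply/andP; split; nra.
Qed.

Lemma cosD2piz (a : R) (k : int) : cos (a + pi *+ 2 * k%:~R) = cos a.
Proof.
have per n b : cos (b + pi *+ 2 * n%:R) = cos b :> R.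
  by rewrite mulr_natr; exact: (periodicn (@cosD2pi R)).
case: k => n; first exact: per.
by rewrite NegzE -[RHS](per n.+1) -(per n.+1) mulrNz mulrN subrK.
Qed.

Lemma wave_mul t h : wave t * wave (t + h) = (cos (angle h) + wave (2 * t + h)) / 2.
Proof.
have -> : angle h = angle (t + h) - angle t by rewrite /angle; field.
rewrite /wave.
have -> : angle (2 * t + h) = angle (t + h) + angle t by rewrite /angle; field.
by rewrite cosB cosD; field.
Qed.

(** Both factors change sign together when [t] moves by [2 * T]. *)
Lemma wave_mul_wrap t h : wave (wrap t) * wave (wrap t + h) = wave t * wave (t + h).
Proof.
rewrite !wave_mul; congr ((_ + _) / 2).
rewrite /wave /wrap; set k := Num.floor _.
rewrite -[RHS](cosD2piz _ (- k)); congr cos.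
by rewrite mulrNz /angle; field.
Qed.

(** The two points of a fibre differ by a quarter period of the cosine, which is
    why the sum no longer depends on [t]. *)
Lemma wave_mul_half t h :
  wave t * wave (t + h) + wave (t + T) * wave (t + T + h) = cos (angle h).
Proof.
rewrite !wave_mul.
have -> : wave (2 * (t + T) + h) = - wave (2 * t + h).
  by rewrite /wave -cosDpi; congr cos; rewrite /angle; field.
by field.
Qed.

Lemma bump_ge0 t : 0 <= bump t.
Proof.
rewrite /bump; case: ifP => // /andP[h1 h2]; apply: cos_ge0_pihalf.
have pi0 := pi_gt0 R.
have -> : angle t = pi / 2 * (t / T) by rewrite /angle; field.
have h3 : -1 <= t / T by rewrite ler_pdivlMr // mulN1r.
have h4 : t / T <= 1 by rewrite ler_pdivrMr // mul1r ltW.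
by apply/andP; split; nra.
Qed.

Lemma bump_le1 t : bump t <= 1.
Proof. by rewrite /bump; case: ifP => // _; exact: cos_le1. Qed.

Lemma bump_sqr_wrap t : bump (wrap t) ^+ 2 = wave t ^+ 2.
Proof.
rewrite /bump wrap_itv !expr2.
by have := wave_mul_wrap t 0; rewrite !addr0.
Qed.

Lemma bump_sum t : \sum_(s : bool) bump (wrap (t + s%:R * T)) ^+ 2 = 1.
Proof.
rewrite big_bool /= !bump_sqr_wrap mul1r mul0r addr0 addrC.
by have := wave_mul_half t 0; rewrite !addr0 !expr2 /angle mulr0 mul0r cos0.
Qed.

(** Only an inequality: a translated point outside the interval has weight 0. *)
Lemma bump_sum_shift t h : \sum_(s : bool) bump (wrap (t + s%:R * T) + h) ^+ 2 <= 1.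
Proof.
rewrite -[leRHS](bump_sum (t + h)); apply: ler_sum => s _; rewrite (addrAC t h).
have [xin|/negbTE xout] := boolP (- T <= wrap (t + s%:R * T) + h < T).
  by rewrite (wrapD xin).
by rewrite [bump (_ + h)]/bump xout expr0n sqr_ge0.
Qed.

(** Truncating the cosine can only increase the sum: where [x + h] has left the
    interval, [wave x * wave (x + h)] is nonpositive, because [`|h| <= 2 * T]
    keeps [x + h] within the adjacent half period. *)
Lemma bump_overlap t h : `|h| <= 2 * T ->
  cos (angle h) <= \sum_(s : bool) bump (wrap (t + s%:R * T)) * bump (wrap (t + s%:R * T) + h).
Proof.
move=> hT.
have key u : wave u * wave (u + h) <= bump (wrap u) * bump (wrap u + h).
  rewrite -wave_mul_wrap; have := bump_ge0 (wrap u); have := wrap_itv u.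
  move: (wrap u) => x xin; rewrite /bump xin => x0.
  case: ifP => // xh; rewrite mulr0.
  have hh : -(2*T) <= h <= 2 * T by rewrite -ler_norml.
  suff : wave (x + h) <= 0 by nra.
  have pi0 := pi_gt0 R.
  case/andP: xin => x1 x2; case/andP: hh => h1 h2.
  have [xh1|xh1] := leP T (x + h).
    have -> : wave (x + h) = - wave (x + h - 2 * T).
      by rewrite /wave -cosDpi; congr cos; rewrite /angle; field.
    have [e|ne] := eqVneq (x + h - 2 * T) T.
      by exfalso; move: e; nra.
    have := bump_ge0 (x + h - 2 * T); rewrite /bump.
    rewrite ifT ?oppr_le0 //; apply/andP; split; lra.
  have xh2 : x + h < - T by rewrite ltNge; apply/negP => xh2; move: xh; rewrite xh2 xh1.
  rewrite -[wave (x + h)]opprK.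
  have <- : wave (x + h + 2 * T) = - wave (x + h).
    by rewrite /wave -cosDpi; congr cos; rewrite /angle; field.
  have := bump_ge0 (x + h + 2 * T); rewrite /bump.
  rewrite ifT ?oppr_le0 //; apply/andP; split; lra.
rewrite -(wave_mul_half t h) big_bool /= mul1r mul0r addr0 addrC.
exact: lerD.
Qed.

End Fibres.
(** * Overlap of two weights by their Hellinger affinity *)

Lemma sin_sqr_le (R : realType) (a : R) : sin a ^+ 2 <= a ^+ 2.
Proof.
wlog a0 : a / 0 < a.
  move=> le_pos; have [a0|a0|<-] := ltgtP 0 a; first exact: le_pos.
    by rewrite -(sqrrN (sin a)) -sinN -(sqrrN a); apply: le_pos; rewrite oppr_gt0.
  by rewrite sin0.
have [|c _] := MVT a0 (fun x _ => is_derive_sin x).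
  by apply: continuous_subspaceT => x; exact: continuous_sin.
by rewrite sin0 !subr0 => ->; rewrite exprMn ler_piMl ?sqr_ge0 //.
Qed.

(** Weierstrass product inequality. *)
Lemma prod_1B_ge (R : realFieldType) (I : finType) (a : I -> R) :
  (forall i, 0 <= a i <= 1) -> 1 - \sum_i a i <= \prod_i (1 - a i).
Proof.
move=> a01.
suff: 1 - \sum_i a i <= \prod_i (1 - a i) /\ 0 <= \prod_i (1 - a i) <= 1 by case.
apply: (big_ind2 (fun S P => 1 - S <= P /\ 0 <= P <= 1)).
- by rewrite subr0 lexx ler01.
- by move=> S1 P1 S2 P2 [h1 /andP[h2 h3]] [h4 /andP[h5 h6]]; split; [nra | apply/andP; split; nra].
- by move=> i _; case/andP: (a01 i) => h1 h2; split; [lra | apply/andP; split; lra].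
Qed.

Lemma cauchy_schwarz_sum (R : realFieldType) (I : finType) (x y : I -> R) :
  (\sum_i x i * y i) ^+ 2 <= (\sum_i x i ^+ 2) * (\sum_i y i ^+ 2).
Proof.
(* Lagrange's identity *)
have : 0 <= \sum_i \sum_j (x i * y j - x j * y i) ^+ 2.
  by apply: sumr_ge0 => i _; apply: sumr_ge0 => j _; exact: sqr_ge0.
have -> : \sum_i \sum_j (x i * y j - x j * y i) ^+ 2 =
    (\sum_i \sum_j x i ^+ 2 * y j ^+ 2) + (\sum_i \sum_j y i ^+ 2 * x j ^+ 2)
    - 2 * (\sum_i \sum_j (x i * y i) * (x j * y j)).
  rewrite mulr_sumr -sumrN -!big_split; apply: eq_bigr => i _ /=.
  rewrite mulr_sumr -sumrN -!big_split; apply: eq_bigr => j _ /=.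
  by ring.
have mul_sum (a b : I -> R) : \sum_i \sum_j a i * b j = (\sum_i a i) * (\sum_i b i).
  by rewrite mulr_suml; apply: eq_bigr => i _; rewrite mulr_sumr.
rewrite !mul_sum => h; nra.
Qed.

(** With [s] the sum of the minima, the sum of the maxima is at most [2 - s], and
    [a * b] is the product of minimum and maximum; Cauchy-Schwarz then gives
    [C ^+ 2 <= s * (2 - s)].  When both families of squares sum to 1, [1 - s] is their
    total variation distance. *)
Lemma min_sum_ge (R : realFieldType) (I : finType) (a b : I -> R) (C : R) :
  (forall i, 0 <= a i) -> (forall i, 0 <= b i) ->
  \sum_i a i ^+ 2 = 1 -> \sum_i b i ^+ 2 <= 1 ->
  0 <= C -> C <= \sum_i a i * b i ->
  (1 - \sum_i Num.min (a i ^+ 2) (b i ^+ 2)) ^+ 2 <= 1 - C ^+ 2.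
Proof.
move=> a0 b0 a1 b1 C0 Cle.
have le_ab i : (a i ^+ 2 <= b i ^+ 2) = (a i <= b i) by rewrite ler_sqr ?nnegrE.
have -> : \sum_i Num.min (a i ^+ 2) (b i ^+ 2) = \sum_i Num.min (a i) (b i) ^+ 2.
  apply: eq_bigr => i _; case: (leP (a i) (b i)) => h.
    by rewrite min_l // le_ab.
  by rewrite min_r // ltW // ltNge le_ab -ltNge.
set s := \sum_i _.
have maxE : \sum_i Num.max (a i) (b i) ^+ 2 = 1 + (\sum_i b i ^+ 2) - s.
  rewrite -a1 -big_split -sumrB; apply: eq_bigr => i _ /=.
  by case: (leP (a i) (b i)) => _; ring.
have := cauchy_schwarz_sum (fun i => Num.min (a i) (b i)) (fun i => Num.max (a i) (b i)).
have -> : \sum_i Num.min (a i) (b i) * Num.max (a i) (b i) = \sum_i a i * b i.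
  by apply: eq_bigr => i _; case: (leP (a i) (b i)) => _; ring.
have s0 : 0 <= s by apply: sumr_ge0 => i _; exact: sqr_ge0.
rewrite maxE -/s; nra.
Qed.

(** * The density on the cube *)

Section Cube.
Context (R : realType) (T : R) (d : nat).
Hypothesis T_gt0 : 0 < T.
Implicit Types (x y u v : 'rV[R]_d) (W g : 'rV[R]_d -> R).

Definition cube x : bool := [forall i, - T <= x ord0 i < T].
Definition wrapv y : 'rV[R]_d := \row_i wrap T (y ord0 i).
Definition density x : R := \prod_i bump T (x ord0 i) ^+ 2.
Definition corner (s : {ffun 'I_d -> bool}) : 'rV[R]_d := \row_i ((s i)%:R * T).
Definition fibre_sum W y : R := \sum_s W (y + corner s).
(** The mass that the Metropolis rule moves by the step [u]. *)
Definition overlap u y : R := Num.min (density (wrapv y)) (density (wrapv y + u)).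

Lemma wrapv_cube y : cube (wrapv y).
Proof. by apply/forallP => i; rewrite mxE wrap_itv. Qed.

Lemma wrapvD y u : cube (wrapv y + u) -> wrapv (y + u) = wrapv y + u.
Proof.
move=> /forallP hc; apply/rowP => i; have := hc i.
by rewrite !mxE => /(wrapD T_gt0) ->.
Qed.

Lemma density_ge0 x : 0 <= density x.
Proof. by apply: prodr_ge0 => i _; exact: sqr_ge0. Qed.

Lemma density_le1 x : density x <= 1.
Proof.
apply: prodr_ile1 => i _; rewrite sqr_ge0 /=.
by rewrite expr_le1 ?bump_le1 ?bump_ge0.
Qed.

Lemma density_out x : ~~ cube x -> density x = 0.
Proof.
rewrite negb_forall => /existsP[i xi]; rewrite /density (bigD1 i) //=.
by rewrite {1}/bump (negbTE xi) expr0n mul0r.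
Qed.

(** The fibre is a product of two-point fibres, and each factor sums to 1. *)
Lemma fibre_sum_density y : fibre_sum (fun z => density (wrapv z)) y = 1.
Proof.
rewrite /fibre_sum /density.
pose F i (s : bool) := bump T (wrap T (y ord0 i + s%:R * T)) ^+ 2.
transitivity (\sum_(s : {ffun 'I_d -> bool}) \prod_i F i (s i)).
  by apply: eq_bigr => s _; apply: eq_bigr => i _; rewrite !mxE.
by rewrite -bigA_distr_bigA big1 // => i _; exact: bump_sum.
Qed.

(** The mass rejected on a fibre is at most the norm of the vector of angles
    [pi * v_i / (2 * T)]: its square is at most [1 - \prod_i cos (angle_i) ^+ 2],
    which is at most the sum of the [sin (angle_i) ^+ 2]. *)
Lemma fibre_sum_overlap y v :
  1 - pi / (2 * T) * l2norm v <= fibre_sum (overlap v) y.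
Proof.
rewrite /fibre_sum lerBlDr -lerBlDl.
set s := \sum_s _.
have s0 : 0 <= s.
  by apply: sumr_ge0 => i _; rewrite le_min !density_ge0.
have pi0 := pi_gt0 R; have T2 : 0 < 2 * T by rewrite mulr_gt0.
have c0 : 0 <= pi / (2 * T) by rewrite divr_ge0 // ltW.
have n0 : 0 <= l2norm v by exact: sqrtr_ge0.
have nE : (pi / (2 * T) * l2norm v) ^+ 2 = \sum_i angle T (v ord0 i) ^+ 2.
  rewrite exprMn sqr_sqrtr; last by apply: sumr_ge0 => i _; exact: sqr_ge0.
  by rewrite mulr_sumr; apply: eq_bigr => i _; rewrite -exprMn mulrAC.
have r0 : 0 <= pi / (2 * T) * l2norm v by rewrite mulr_ge0.
(* If the norm is at least 1 the claim is trivial; otherwise all cosines are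
   nonnegative and all coordinates of v at most 2T. *)
have [big|small] := leP 1 (pi / (2 * T) * l2norm v); first by lra.
have sum1 : \sum_i angle T (v ord0 i) ^+ 2 < 1.
  by rewrite -nE expr_lt1.
have angle1 i : angle T (v ord0 i) ^+ 2 < 1.
  apply: le_lt_trans sum1; rewrite (bigD1 i) //= lerDl.
  by apply: sumr_ge0 => j _; exact: sqr_ge0.
have cos0 i : 0 <= cos (angle T (v ord0 i)).
  apply: cos_ge0_pihalf; have := angle1 i; have := pi_ge2 R.
  move: (angle _ _) => a pi2 a1; apply/andP; split; nra.
have small_step i : `|v ord0 i| <= 2 * T.
  have : `|angle T (v ord0 i)| < 1 by rewrite -(@expr_lt1 _ 2) // real_normK ?num_real.
  rewrite /angle !normrM (gtr0_norm pi0) normfV (gtr0_norm T2) ltr_pdivrMr // mul1r.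
  have := pi_ge2 R; have := normr_ge0 (v ord0 i).
  by move: `|_| => a a0 pi2; nra.
have : (1 - s) ^+ 2 <= 1 - (\prod_i cos (angle T (v ord0 i))) ^+ 2.
  pose x sg := wrapv (y + corner sg).
  pose f (z : 'rV[R]_d) := \prod_i bump T (z ord0 i).
  have fE z : f z ^+ 2 = density z by rewrite /f -prodrXl.
  have f0 z : 0 <= f z by apply: prodr_ge0 => i _; exact: bump_ge0.
  have -> : s = \sum_sg Num.min (f (x sg) ^+ 2) (f (x sg + v) ^+ 2).
    by apply: eq_bigr => sg _; rewrite !fE.
  apply: min_sum_ge => //.
  - by rewrite -(fibre_sum_density y); apply: eq_bigr => sg _; rewrite fE.
  - pose F i (b : bool) := bump T (wrap T (y ord0 i + b%:R * T) + v ord0 i) ^+ 2.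
    rewrite (eq_bigr (fun sg : {ffun _ -> _} => \prod_i F i (sg i))); last first.
      by move=> sg _; rewrite fE; apply: eq_bigr => i _; rewrite !mxE.
    rewrite -bigA_distr_bigA; apply: prodr_ile1 => i _.
    rewrite bump_sum_shift // andbT.
    by apply: sumr_ge0 => b _; exact: sqr_ge0.
  - by apply: prodr_ge0.
  - pose F i (b : bool) := let t := wrap T (y ord0 i + b%:R * T) in
      bump T t * bump T (t + v ord0 i).
    rewrite (eq_bigr (fun sg : {ffun _ -> _} => \prod_i F i (sg i))); last first.
      by move=> sg _; rewrite -big_split; apply: eq_bigr => i _; rewrite !mxE.
    rewrite -bigA_distr_bigA; apply: ler_prod => i _.
    by rewrite cos0 bump_overlap.
rewrite -prodrXl => tv.
have : 1 - \sum_i angle T (v ord0 i) ^+ 2 <= \prod_i cos (angle T (v ord0 i)) ^+ 2.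
  rewrite [leRHS](eq_bigr (fun i => 1 - sin (angle T (v ord0 i)) ^+ 2)); last first.
    by move=> i _; rewrite cos2sin2.
  apply: le_trans (prod_1B_ge _); last first.
    move=> i; rewrite sqr_ge0 /=.
    by apply: le_trans (sin_sqr_le _) _; exact: ltW.
  by rewrite lerD2l lerN2; apply: ler_sum => i _; exact: sin_sqr_le.
rewrite -nE => cs; nra.
Qed.

End Cube.
(** * The optimal cost and its average over starting points *)

Section Cost.
Context (R : realType) (T : R) (d : nat).
Hypothesis T_gt0 : 0 < T.
Implicit Types (x y u v : 'rV[R]_d) (C W g : 'rV[R]_d -> R) (vs : seq 'rV[R]_d).
Local Notation cube := (cube T).
Local Notation density := (density T).
Local Notation wrapv := (wrapv T).
Local Notation overlap := (overlap T).
Local Notation fibre_sum := (fibre_sum T).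

(** [C] is the expected number of later discards as a function of the position. *)
Definition keep C x u : bool := cube (x + u) && (C (x + u) <= 1 + C x).

Definition step_cost C x u : R := if keep C x u then C (x + u) else 1 + C x.

(** Bellman recursion for the minimal expected number of discards when the vectors
    [vs] are still to come, each with a fair sign. *)
Fixpoint expected_cost vs : 'rV[R]_d -> R :=
  if vs is v :: vs' then
    fun x => (step_cost (expected_cost vs') x v
              + step_cost (expected_cost vs') x (- v)) / 2
  else fun=> 0.

Lemma expected_cost_itv vs x : 0 <= expected_cost vs x <= (size vs)%:R.
Proof.
elim: vs x => [|v vs IH] x /=; first by rewrite lexx.
have step u : 0 <= step_cost (expected_cost vs) x u <= (size vs)%:R + 1.
  rewrite /step_cost; have /andP[h1 h2] := IH x; have /andP[h3 h4] := IH (x + u).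
  by case: ifP => _; apply/andP; split; lra.
have /andP[h1 h2] := step v; have /andP[h3 h4] := step (- v).
by rewrite -(natr1 (size vs)); apply/andP; split; lra.
Qed.

Lemma expected_cost_dyadic vs x :
  exists k : nat, expected_cost vs x * 2 ^+ size vs = k%:R.
Proof.
elim: vs x => [|v vs IH] x /=; first by exists 0%N; rewrite mul0r.
have step u : exists k : nat, step_cost (expected_cost vs) x u * 2 ^+ size vs = k%:R.
  rewrite /step_cost; case: ifP => _ //.
  have [k kE] := IH x; exists (2 ^ size vs + k)%N.
  by rewrite mulrDl mul1r kE natrD natrX.
have [k1 k1E] := step v; have [k2 k2E] := step (- v).
by exists (k1 + k2)%N; rewrite natrD -k1E -k2E exprS; field.
Qed.

(** The change in [C]-cost carried by the mass that moves from [y] along [u]. *)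
Definition flux C u y : R := overlap u y * (C (wrapv y + u) - C (wrapv y)).

(** Detailed balance: the mass moving from [y] to [y - v] equals the mass moving
    back, and the cost change is the opposite one. *)
Lemma fluxN C v y : flux C (- v) y = - flux C v (y - v).
Proof.
rewrite /flux /overlap.
have [xin|xout] := boolP (cube (wrapv y - v)).
  by rewrite (wrapvD T_gt0 xin) subrK minC; ring.
have [xin'|xout'] := boolP (cube (wrapv (y - v) + v)).
  have := wrapvD T_gt0 xin'; rewrite subrK => e; move: xout.
  by rewrite e addrK wrapv_cube.
rewrite (density_out xout) (density_out xout') !min_r ?density_ge0 //.
by rewrite !mul0r oppr0.
Qed.

Lemma flux_bound vs v y : `|flux (expected_cost vs) v y| <= (size vs)%:R.
Proof.
rewrite normrM -[leRHS]mul1r; apply: ler_pM => //.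
  rewrite ger0_norm ?le_min ?density_ge0 //.
  by rewrite ge_min density_le1.
have /andP[h1 h2] := expected_cost_itv vs (wrapv y + v).
have /andP[h3 h4] := expected_cost_itv vs (wrapv y).
by rewrite ler_norml; apply/andP; split; lra.
Qed.

Definition weighted C y : R := density (wrapv y) * C (wrapv y).

(** The optimal decision is at least as good as the randomised Metropolis one. *)
Lemma step_cost_le C u y :
  density (wrapv y) * step_cost C (wrapv y) u <=
  weighted C y + density (wrapv y) - overlap u y + flux C u y.
Proof.
rewrite /weighted /flux /overlap; set x := wrapv y; set m := Num.min _ _.
have m0 : 0 <= m by rewrite le_min !density_ge0.
have mx : m <= density x by rewrite ge_min lexx.
rewrite /step_cost /keep; have [xin|xout] /= := boolP (cube (x + u)).
  by clearbody m; case: (leP (C (x + u)) (1 + C x)) => h; nra.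
by rewrite /m (density_out xout) min_r ?density_ge0 //; lra.
Qed.

Lemma weighted_cost_step v vs y (C := expected_cost vs) :
  weighted (expected_cost (v :: vs)) y <=
  weighted C y + (density (wrapv y) - (overlap v y + overlap (- v) y) / 2)
  + (flux C v y - flux C v (y - v)) / 2.
Proof.
rewrite -[- flux _ _ (y - v)]fluxN [weighted _ y in leLHS]/weighted /= -/C.
have := step_cost_le C v y; have := step_cost_le C (- v) y; lra.
Qed.

(** Averaged over a fibre, one more vector costs at most the rejected mass, up to a
    difference that telescopes along [v]. *)
Lemma fibre_cost_step v vs y (C := expected_cost vs) :
  fibre_sum (weighted (expected_cost (v :: vs))) y <=
  fibre_sum (weighted C) y + pi / (2 * T) * l2norm v
  + (fibre_sum (flux C v) y - fibre_sum (flux C v) (y - v)) / 2.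
Proof.
pose rej z := density (wrapv z) - (overlap v z + overlap (- v) z) / 2.
have rej_le : fibre_sum rej y <= pi / (2 * T) * l2norm v.
  have -> : fibre_sum rej y = 1 - (fibre_sum (overlap v) y + fibre_sum (overlap (- v)) y) / 2.
    rewrite -[X in X - _](fibre_sum_density T_gt0 y) /fibre_sum -big_split mulr_suml -sumrB.
    by apply: eq_bigr.
  have := fibre_sum_overlap T_gt0 y v; have := fibre_sum_overlap T_gt0 y (- v).
  have -> : l2norm (- v) = l2norm v.
    by rewrite /l2norm; congr Num.sqrt; apply: eq_bigr => i _; rewrite mxE sqrrN.
  lra.
apply: le_trans (_ : fibre_sum (fun z => weighted C z + rej z
    + (flux C v z - flux C v (z - v)) / 2) y <= _).
  by apply: ler_sum => s _; exact: weighted_cost_step.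
clearbody rej; rewrite /fibre_sum !big_split -mulr_suml sumrB /=.
have -> : \sum_s flux C v (y + corner T s - v) = fibre_sum (flux C v) (y - v).
  by apply: eq_bigr => s _; rewrite addrAC.
by move: rej_le; rewrite /fibre_sum; lra.
Qed.

(** Average over the points [y + \sum_j c_j v_j] with all [c_j < M]. *)
Fixpoint box_avg (M : nat) vs W y : R :=
  if vs is v :: vs' then M%:R^-1 * \sum_(c < M) box_avg M vs' W (y + v *+ c)
  else W y.

Lemma box_avg_itv (M : nat) vs W (a b : R) : (0 < M)%N ->
  (forall y, a <= W y <= b) -> forall y, a <= box_avg M vs W y <= b.
Proof.
move=> M0 Wab; elim: vs => [|v vs IH] y //=.
have M0' : 0 < M%:R :> R by rewrite ltr0n.
rewrite mulrC ler_pdivlMr // ler_pdivrMr // !mulr_natr.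
rewrite -[M in a *+ M]card_ord -[M in b *+ M]card_ord -!sumr_const.
by apply/andP; split; apply: ler_sum => c _; case/andP: (IH (y + v *+ c)).
Qed.

Lemma box_avg_le (M : nat) vs W W' g v (e : R) : (0 < M)%N ->
  (forall y, W y <= W' y + e + (g y - g (y - v)) / 2) ->
  forall y, box_avg M vs W y <=
    box_avg M vs W' y + e + (box_avg M vs g y - box_avg M vs g (y - v)) / 2.
Proof.
move=> M0 WW'; elim: vs => [|u vs IH] y //=.
have M0' : 0 < M%:R :> R by rewrite ltr0n.
rewrite mulrC ler_pdivrMr //.
have -> : forall a b c : R, (M%:R^-1 * a + e + (M%:R^-1 * b - M%:R^-1 * c) / 2) * M%:R
    = a + e *+ M + (b - c) / 2.
  by move=> a b c; rewrite -mulr_natr; field; rewrite gt_eqF.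
rewrite -[M in e *+ M]card_ord -sumr_const -sumrB mulr_suml -!big_split /=.
by apply: ler_sum => c _; rewrite (addrAC y (- v)); exact: IH.
Qed.

(** Along the coordinate of [v] the differences telescope, leaving two values of
    size at most [B] among [M] terms. *)
Lemma box_avg_telescope (M : nat) vs W W' g v (e B : R) : (0 < M)%N ->
  v \in vs -> (forall y, `|g y| <= B) ->
  (forall y, W y <= W' y + e + (g y - g (y - v)) / 2) ->
  forall y, box_avg M vs W y <= box_avg M vs W' y + e + B / M%:R.
Proof.
move=> M0 vin gB WW'.
have M0' : 0 < M%:R :> R by rewrite ltr0n.
elim: vs vin => [|u vs IH] //; rewrite inE => vin y.
have finish (a : R) (F G : 'I_M -> R) : \sum_c F c <= \sum_c G c + e *+ M + a ->
    M%:R^-1 * \sum_c F c <= M%:R^-1 * \sum_c G c + e + a / M%:R.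
  move=> h; rewrite mulrC ler_pdivrMr //; apply: le_trans h _.
  by rewrite le_eqVlt; apply/orP; left; apply/eqP; rewrite -mulr_natr; field; rewrite gt_eqF.
rewrite /=; apply: finish.
have eE : e *+ M = \sum_(c < M) e by rewrite sumr_const card_ord.
have [vu|vu] := eqVneq v u; last first.
  rewrite (negbTE vu) /= in vin.
  have -> : B = \sum_(c < M) B / M%:R.
    by rewrite sumr_const card_ord -[RHS]mulr_natr divfK // gt_eqF.
  by rewrite eE -!big_split /=; apply: ler_sum => c _; exact: IH.
pose h k := box_avg M vs g (y + v *+ k - v).
apply: le_trans (_ : \sum_(c < M) (box_avg M vs W' (y + u *+ c) + e
    + (h c.+1 - h c) / 2) <= _).
  apply: ler_sum => c _; have := box_avg_le vs M0 WW' (y + u *+ c).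
  by rewrite /h -vu (mulrSr _ c) addrA addrK.
rewrite !big_split /= -mulr_suml -eE lerD2l.
rewrite -(big_mkord xpredT (fun c => h c.+1 - h c)) telescope_sumr //.
have gB' z : - B <= g z <= B by rewrite -ler_norml.
have /andP[h1 h2] := box_avg_itv vs M0 gB' (y + v *+ M - v).
have /andP[h3 h4] := box_avg_itv vs M0 gB' (y + v *+ 0 - v).
rewrite /h; lra.
Qed.

Lemma box_avg_cost (M : nat) vs0 vs y (K : R := #|{ffun 'I_d -> bool}|%:R * (size vs0)%:R) :
  (0 < M)%N -> {subset vs <= vs0} -> (size vs <= size vs0)%N ->
  box_avg M vs0 (fibre_sum (weighted (expected_cost vs))) y <=
  pi / (2 * T) * \sum_(v <- vs) l2norm v + (size vs)%:R * (K / M%:R).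
Proof.
move=> M0; elim: vs => [|v vs IH] sub size_le.
  rewrite big_nil mulr0 mul0r addr0.
  have W0 z : 0 <= fibre_sum (weighted (expected_cost [::])) z <= 0.
    by rewrite /fibre_sum big1 ?lexx // => s _; rewrite /weighted mulr0.
  by case/andP: (box_avg_itv vs0 M0 W0 y).
have sub' : {subset vs <= vs0} by move=> z zin; apply: sub; rewrite inE zin orbT.
have vin : v \in vs0 by apply: sub; rewrite inE eqxx.
have fluxK z : `|fibre_sum (flux (expected_cost vs) v) z| <= K.
  apply: le_trans (ler_norm_sum _ _ _) _.
  rewrite /K mulr_natl -sumr_const; apply: ler_sum => s _.
  by apply: le_trans (flux_bound _ _ _) _; rewrite ler_nat ltnW.
apply: le_trans (box_avg_telescope M0 vin fluxK (fibre_cost_step v vs) y) _.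
have := IH sub' (ltnW size_le).
by rewrite big_cons mulrDr /= -(natr1 (size vs)) [(_ + 1) * _]mulrDl mul1r; lra.
Qed.

(** If every start were too expensive, each would exceed the bound by a gap
    independent of [M], the cost being a multiple of [2 ^- size vs]; this contradicts
    the averaged bound for large [M]. *)
Lemma cheap_start vs :
  exists2 x, cube x &
    expected_cost vs x <= pi / (2 * T) * \sum_(v <- vs) l2norm v.
Proof.
set b := _ * _; pose N : R := 2 ^+ size vs.
have N0 : 0 < N by rewrite exprn_gt0.
apply: contrapT => no_start.
pose b' := (Num.floor (b * N) + 1)%:~R / N.
have bb' : b < b' by rewrite ltr_pdivlMr // floorD1_gt.
have cost_ge x : cube x -> b' <= expected_cost vs x.
  move=> xin; have /negP := (fun h => no_start (ex_intro2 _ _ x xin h)).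
  rewrite -ltNge -(ltr_pM2r N0) ler_pdivrMr //.
  have [k ->] := expected_cost_dyadic vs x.
  by rewrite -[k%:R]/(k%:~R) -floor_lt_int ler_int lezD1.
pose K : R := (size vs)%:R * (#|{ffun 'I_d -> bool}|%:R * (size vs)%:R).
pose M := (Num.truncn (K / (b' - b))).+1.
have M0 : (0 < M)%N by [].
have := box_avg_cost 0 M0 (fun z => id) (leqnn (size vs)).
rewrite -/b => avg_le.
have W_ge z : b' <= fibre_sum (weighted (expected_cost vs)) z.
  rewrite -[leLHS]mul1r -[X in X * _ <= _](fibre_sum_density T_gt0 z) mulr_suml.
  apply: ler_sum => s _; apply: ler_wpM2l; first exact: density_ge0.
  exact/cost_ge/wrapv_cube.
have W_le z : fibre_sum (weighted (expected_cost vs)) z <= (size vs)%:R.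
  rewrite -[leRHS]mul1r -[X in _ <= X * _](fibre_sum_density T_gt0 z) mulr_suml.
  apply: ler_sum => s _; apply: ler_wpM2l; first exact: density_ge0.
  by case/andP: (expected_cost_itv vs (wrapv (z + corner T s))).
have W_itv z : b' <= fibre_sum (weighted (expected_cost vs)) z <= (size vs)%:R.
  by rewrite W_ge W_le.
have /andP[avg_ge _] := box_avg_itv vs M0 W_itv 0.
have : K / (b' - b) < M%:R by exact: truncnS_gt.
rewrite ltr_pdivrMr ?subr_gt0 // => KM.
have := le_trans avg_ge avg_le; rewrite mulrA -/K -lerBlDl ler_pdivlMr ?ltr0n //.
by rewrite leNgt mulrC KM.
Qed.

End Cost.
(** * The algorithm that follows the optimal decisions *)

Section Strategy.
Context (R : realType) (T : R) (d : nat).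
Implicit Types (x u v : 'rV[R]_d) (vs h : seq 'rV[R]_d).
Local Notation cube := (cube T).
Local Notation expected_cost := (expected_cost T).

(** The steps [h] are met from position [x]; a step other than [v] or [- v] is
    discarded. *)
Fixpoint decisions vs x h : seq bool :=
  match vs, h with
  | v :: vs', u :: h' =>
    let a := ((u == v) || (u == - v)) && keep T (expected_cost vs') x u in
    a :: decisions vs' (if a then x + u else x) h'
  | _, _ => [::]
  end.

Lemma size_decisions vs x h : size h = size vs -> size (decisions vs x h) = size h.
Proof.
by elim: vs x h => [|v vs IH] x [|u h] //= [/IH ->].
Qed.

(** The decisions are online. *)
Lemma decisions_take vs x h k : decisions vs x (take k h) = take k (decisions vs x h).
Proof.
elim: vs x h k => [|v vs IH] x [|u h] [|k] //=.
by rewrite IH.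
Qed.

Lemma cube_walk vs x h k : cube x ->
  cube (x + \sum_(0 <= i < k | nth false (decisions vs x h) i) nth 0 h i).
Proof.
elim: vs x h k => [|v vs IH] x [|u h] k xin /=;
  try by rewrite big1 ?addr0 // => i; rewrite nth_nil.
case: k => [|k]; first by rewrite big_geq ?addr0.
rewrite big_mkcond big_nat_recl //= -big_mkcond /=.
case: ifP => [/andP[_ /andP[uin _]]|_]; first by rewrite addrA; exact: IH.
by rewrite add0r; exact: IH.
Qed.

Definition sign_class (r : R) : option bool :=
  if r == 1 then Some true else if r == -1 then Some false else None.

Definition class_sign (o : option bool) : R :=
  if o is Some b then (-1) ^+ ~~ b else 0.

(** A coefficient other than 1 or -1 may be replaced by 0: if [v i != 0] both steps
    are discarded, and if [v i = 0] both steps are the same. *)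
Lemma decisions_sign_class (I : Type) (l : seq I) (v : I -> 'rV[R]_d) (s : I -> R) x :
  decisions [seq v i | i <- l] x [seq s i *: v i | i <- l] =
  decisions [seq v i | i <- l] x
    [seq class_sign (sign_class (s i)) *: v i | i <- l].
Proof.
elim: l x => //= i l IH x.
rewrite {1 2 3 4 5 6}/class_sign /sign_class.
have [->|s1] := eqVneq (s i) 1; first by rewrite !expr0 IH.
have [->|sN1] := eqVneq (s i) (-1); first by rewrite !expr1 IH.
have [->|v0] := eqVneq (v i) 0; first by rewrite !scaler0 IH.
have scaleE a b : (a *: v i == b *: v i) = (a == b).
  by rewrite -subr_eq0 -scalerBl scaler_eq0 (negbTE v0) orbF subr_eq0.
have e1 a : (a *: v i == v i) = (a == 1) by rewrite -scaleE scale1r.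
have eN a : (a *: v i == - v i) = (a == -1) by rewrite -scaleE scaleN1r.
by rewrite !e1 !eN (negbTE s1) (negbTE sN1) eq_sym oner_eq0 eq_sym oppr_eq0 oner_eq0 IH.
Qed.

Definition class_prob (o : option bool) : R := if o is Some _ then 2^-1 else 0.

Lemma big_option_bool (G : option bool -> R) :
  \sum_o class_prob o * G o = (G (Some true) + G (Some false)) / 2.
Proof.
rewrite (bigD1 (Some true)) // (bigD1 (Some false)) //= big1.
  by rewrite addr0 -mulrDr mulrC.
by case=> [[]|] //= _; rewrite mul0r.
Qed.

Lemma big_tuple_cons (A : finType) n (F : n.+1.-tuple A -> R) :
  \sum_(c : n.+1.-tuple A) F c = \sum_(o : A) \sum_(c : n.-tuple A) F [tuple of o :: c].
Proof.
rewrite pair_bigA /=.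
rewrite (reindex (fun p : A * n.-tuple A => [tuple of p.1 :: p.2])) //=.
exists (fun c : n.+1.-tuple A => (thead c, behead_tuple c)) => [[a c] _|c _] /=.
  by congr (_, _); apply: val_inj.
by rewrite -tuple_eta.
Qed.

Lemma sum_prod_tuple (A : finType) n (q : A -> R) : \sum_o q o = 1 ->
  \sum_(c : n.-tuple A) \prod_i q (tnth c i) = 1.
Proof.
move=> q1; elim: n => [|n IH].
  rewrite (big_pred1 [tuple]) ?big_ord0 // => c.
  by apply/esym/eqP; exact: tuple0.
rewrite big_tuple_cons -[RHS]q1; apply: eq_bigr => o _.
rewrite -[RHS]mulr1 -[in RHS]IH mulr_sumr; apply: eq_bigr => c _.
by rewrite big_ord_recl tnth0; congr (_ * _); apply: eq_bigr => i _; rewrite tnthS.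
Qed.

(** The recursion of [expected_cost] is the law of total expectation over the first
    sign. *)
Lemma mean_discards n vs x : size vs = n ->
  \sum_(c : n.-tuple (option bool)) (\prod_i class_prob (tnth c i)) *
    (count negb (decisions vs x [seq class_sign p.1 *: p.2 | p <- zip c vs]))%:R
  = expected_cost vs x.
Proof.
elim: n vs x => [|n IH] [|v vs] x //=.
  by move=> _; apply: big1 => c _; rewrite mulr0.
move=> [sz]; rewrite big_tuple_cons.
pose a o := let u := class_sign o *: v in
  ((u == v) || (u == - v)) && keep T (expected_cost vs) x u.
pose next o := if a o then x + class_sign o *: v else x.
rewrite (eq_bigr (fun o => class_prob o * ((~~ a o)%:R + expected_cost vs (next o)))).
  rewrite big_option_bool /next /a /= !expr0 !expr1 scale1r scaleN1r !eqxx orbT /=.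
  rewrite /step_cost; congr ((_ + _) / 2); case: ifP => _ /=; by rewrite ?add0r.
move=> o _; rewrite -(IH vs (next o) sz).
have q1 : \sum_o class_prob o = 1.
  rewrite (eq_bigr (fun o => class_prob o * 1)) => [|? _]; last by rewrite mulr1.
  by rewrite big_option_bool; field.
rewrite -[(~~ a o)%:R]mul1r -[X in X * (~~ _)%:R](sum_prod_tuple n q1).
rewrite mulr_suml -big_split mulr_sumr; apply: eq_bigr => c _ /=.
rewrite big_ord_recl tnth0 -mulrA; congr (_ * _).
have -> : \prod_(i < n) class_prob (tnth [tuple of o :: c] (lift ord0 i)) =
    \prod_i class_prob (tnth c i).
  by apply: eq_bigr => i _; congr class_prob; exact: tnthS.
by rewrite -mulrDr -natrD.
Qed.

Lemma cube_dist x y : 0 < T -> cube x -> cube y -> `|x - y| <= 2 * T.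
Proof.
move=> T0 /forallP xin /forallP yin.
rewrite /Num.norm /= mx_normrE; apply: bigmax_le => [|[i j] _] /=.
  by rewrite mulr_ge0 // ltW.
rewrite !mxE ord1; have /andP[x1 x2] := xin j; have /andP[y1 y2] := yin j.
by rewrite ler_norml; apply/andP; split; lra.
Qed.

End Strategy.
(** * Expectation of a function of the signs *)

Section SignPatterns.
Context (R : realType) (disp : measure_display) (Omega : measurableType disp).
Context (P : probability Omega R) (n : nat) (eps : 'I_n -> {RV P >-> R}).

Definition pattern (w : Omega) : n.-tuple (option bool) :=
  [tuple sign_class (eps i w) | i < n].

Let class_set (a : option bool) : set R := [set r | sign_class r = a].

Lemma class_setE a : class_set a =
  match a with
  | Some true => [set 1]
  | Some false => [set -1]
  | None => ~` ([set 1] `|` [set -1])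
  end.
Proof.
apply/seteqP; split=> r; rewrite /class_set /sign_class /=.
  case: eqP => [->|r1]; first by move=> <-.
  by case: eqP => [->|r2] <- //= [].
case: a => [[]|] /=.
- by move=> ->; rewrite eqxx.
- by move=> ->; rewrite eqxx (_ : -1 == 1 = false) //; apply/eqP; lra.
- by move=> /not_orP[/eqP/negbTE -> /eqP/negbTE ->].
Qed.

Lemma measurable_class_set a : measurable (class_set a).
Proof.
rewrite class_setE; case: a => [[]|]; [exact: measurable_set1..|].
by apply: measurableC; apply: measurableU; exact: measurable_set1.
Qed.

Lemma pattern_preimage c : pattern @^-1` [set c] =
  \bigcap_(i in [set` [set: 'I_n]%SET]) (eps i @^-1` class_set (tnth c i)).
Proof.
apply/seteqP; split=> w /=.
  by move=> <- i _; rewrite /= /class_set /= tnth_mktuple.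
by move=> wc; apply: eq_from_tnth => i; rewrite tnth_mktuple; apply: wc; rewrite /= inE.
Qed.

Lemma measurable_pattern c : measurable (pattern @^-1` [set c]).
Proof.
rewrite pattern_preimage; apply: fin_bigcap_measurable => // i _.
by rewrite -[X in measurable X]setTI; apply: measurable_funP => //; exact: measurable_class_set.
Qed.

Lemma pattern_prob c : (forall j, rademacher P (eps j)) ->
  mutually_independent P (fun j => eps j : Omega -> R) ->
  P (pattern @^-1` [set c]) = (\prod_i class_prob R (tnth c i))%:E.
Proof.
move=> rad indep; rewrite pattern_preimage indep; last first.
  by move=> i _; exact: measurable_class_set.
rewrite -prodEFin; apply: eq_big => [i|i _]; first by rewrite inE.
have [P1 PN1] := rad i; rewrite class_setE.
have mE (r : R) : measurable (eps i @^-1` [set r]).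
  by rewrite -[X in measurable X]setTI; apply: measurable_funP => //; exact: measurable_set1.
case: (tnth c i) => [[]|] //=.
rewrite -preimage_setC preimage_setU probability_setC; last exact: measurableU.
rewrite measureU //; last first.
  apply/seteqP; split=> w //= [->] /eqP; rewrite -subr_eq0 opprK.
  by move=> /eqP h; have : (1 + 1 : R) != 0 by []; rewrite h eqxx.
have -> : (P (eps i @^-1` [set 1%R]) + P (eps i @^-1` [set (-1)%R]) = 1)%E.
  by rewrite [X in (X + _)%E]P1 [X in (_ + X)%E]PN1 -EFinD; congr EFin; field.
by rewrite subee.
Qed.

Lemma pattern_indic (F : n.-tuple (option bool) -> R) w :
  F (pattern w) = \sum_c F c * \1_(pattern @^-1` [set c]) w.
Proof.
rewrite (bigD1 (pattern w)) //= big1 => [|c cw].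
  by rewrite indicE mem_set // mulr1 addr0.
by rewrite indicE memNset ?mulr0 // => wc; rewrite -wc /= eqxx in cw.
Qed.

Lemma measurable_pattern_fun (F : n.-tuple (option bool) -> R) :
  measurable_fun setT (fun w => F (pattern w)).
Proof.
rewrite (_ : (fun _ => _) = fun w => \sum_c F c * \1_(pattern @^-1` [set c]) w); last first.
  by apply/funext => w; exact: pattern_indic.
apply: measurable_sum => c; apply: measurable_funM; first exact: measurable_cst.
exact/measurable_indicP/measurable_pattern.
Qed.

Lemma expectation_pattern (d' : measure_display) (U : measurableType d')
    (Q : probability U R) (F : n.-tuple (option bool) -> R) :
  (forall c, 0 <= F c) -> (forall j, rademacher P (eps j)) ->
  mutually_independent P (fun j => eps j : Omega -> R) ->
  ('E_(P \x Q)[fun wu : Omega * U => F (pattern wu.1)] =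
    (\sum_c (\prod_i class_prob R (tnth c i)) * F c)%R%:E)%E.
Proof.
move=> F0 rad indep; rewrite unlock.
pose B c : set (Omega * U) := (pattern @^-1` [set c]) `*` setT.
have mB c : measurable (B c) by apply: measurableX => //; exact: measurable_pattern.
have FE wu : (F (pattern wu.1))%:E = (\sum_c (F c)%:E * (\1_(B c) wu)%:E)%E.
  rewrite pattern_indic -sumEFin; apply: eq_bigr => c _; rewrite EFinM; congr (_ * _%:E)%E.
  by rewrite !indicE; congr ((nat_of_bool _)%:R); apply/idP/idP; rewrite !inE /B /=; tauto.
under eq_integral do rewrite FE.
have mI c : measurable_fun setT (fun wu => (\1_(B c) wu)%:E : \bar R).
  by apply/measurable_EFinP; exact/measurable_indicP.
rewrite ge0_integral_sum //; last 2 first.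
- by move=> c; apply: emeasurable_funM => //; exact: measurable_cst.
- by move=> c wu _; rewrite mule_ge0 // lee_fin.
rewrite -sumEFin; apply: eq_bigr => c _.
rewrite ge0_integralZl //; last by rewrite lee_fin.
rewrite integral_indic // setIT.
rewrite [X in (_ * X)%E](_ : _ = (P (pattern @^-1` [set c]) * Q setT)%E); last first.
  by apply: product_measure1E => //; exact: measurable_pattern.
by rewrite probability_setT mule1 pattern_prob // -EFinM mulrC.
Qed.

End SignPatterns.

(** * The theorem *)

Lemma take_enum_ord n (j : 'I_n) : [seq i : 'I_n <- enum 'I_n | (i <= j)%N] = take j.+1 (enum 'I_n).
Proof.
apply: (inj_map val_inj); rewrite map_take val_enum_ord.
rewrite -(filter_map val (fun i => i <= j)%N) val_enum_ord.
rewrite take_iota (minn_idPl (ltn_ord j)).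
have -> : iota 0 n = iota 0 j.+1 ++ iota j.+1 (n - j.+1).
  by rewrite -[X in iota X (n - _)]add0n -iotaD subnKC.
rewrite filter_cat.
rewrite (all_filterP _); last by apply/allP => i; rewrite mem_iota.
rewrite (eq_in_filter (a2 := pred0)) ?filter_pred0 ?cats0 // => i.
by rewrite mem_iota => /andP[ji _] /=; apply/negbTE; rewrite -ltnNge.
Qed.

Theorem corollary1p3 (R : realType) (T : R) (T_gt0 : 0 < T) (d n : nat)
    (v : 'I_n -> 'rV[R]_d)
    (disp : measure_display) (Omega : measurableType disp)
    (P : probability Omega R) (eps : 'I_n -> {RV P >-> R})
    (eps_rademacher : forall j, rademacher P (eps j))
    (eps_indep : mutually_independent P (fun j => eps j : Omega -> R)) :
  exists A : online_algorithm R d,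
    let discarded (wu : Omega * seed A) : R :=
      (num_discarded v (fun j => eps j wu.1) wu.2)%:R in
    [/\ forall s : 'I_n -> R, (forall j, s j = 1 \/ s j = -1) ->
          forall (u : seed A) (k : 'I_n), `|accepted_sum v s u k| <= 2 * T,
        measurable_fun setT discarded &
        ('E_(P \x seed_law A)[discarded]
           <= (pi / (2 * T) * \sum_(j < n) l2norm (v j))%:E)%E].
Proof.
pose vs := [seq v i | i <- enum 'I_n].
have size_vs : size vs = n by rewrite size_map size_enum_ord.
have [x0 x0_cube x0_cost] := cheap_start T_gt0 vs.
pose acc (_ : unit) h := last false (decisions T vs x0 h).
pose A := @OnlineAlgorithm R d _ unit (dirac tt) acc (fun h => measurable_cst _).
exists A => discarded.
pose steps (s : 'I_n -> R) := [seq s i *: v i | i <- enum 'I_n].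
have size_steps s : size (steps s) = n by rewrite size_map size_enum_ord.
have size_dec s : size (decisions T vs x0 (steps s)) = n.
  by rewrite size_decisions ?size_steps ?size_vs.
have acceptedE s (u : seed A) j :
    accepted v s u j = nth false (decisions T vs x0 (steps s)) j.
  rewrite /accepted /= /acc /observed take_enum_ord map_take decisions_take.
  by rewrite (last_nth false) size_takel ?size_dec //= nth_take.
have discardE s (u : seed A) :
    num_discarded v s u = count negb (decisions T vs x0 (steps s)).
  rewrite /num_discarded cardsE -sum1_card -sum1_count.
  rewrite (big_nth false) size_dec big_mkord; apply: eq_bigl => j.
  by rewrite unfold_in acceptedE.
pose F (c : n.-tuple (option bool)) : R :=
  (count negb (decisions T vs x0 [seq class_sign R p.1 *: p.2 | p <- zip c vs]))%:R.
have discardedE : discarded = fun wu => F (pattern eps wu.1).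
  apply/funext => wu; rewrite /discarded discardE /F; congr (count _ _)%:R.
  rewrite /steps decisions_sign_class; congr decisions.
  by rewrite /vs /pattern /= zip_map -map_comp.
split.
- move=> s _ u k.
  have -> : accepted_sum v s u k =
      \sum_(0 <= i < k.+1 | nth false (decisions T vs x0 (steps s)) i) nth 0 (steps s) i.
    rewrite big_mkord (big_ord_widen_cond n) // /accepted_sum.
    apply: eq_big => [j|j _]; first by rewrite acceptedE ltnS andbC.
    by rewrite (nth_map j) ?size_enum_ord // nth_ord_enum.
  rewrite -[X in `|X|](addKr x0) addrC.
  by apply: cube_dist => //; exact: cube_walk.
- rewrite discardedE.
  exact: (measurableT_comp (measurable_pattern_fun eps F)).
- rewrite discardedE expectation_pattern //.
  rewrite lee_fin mean_discards //; apply: le_trans x0_cost _.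
  by rewrite big_map big_enum.
Qed.
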